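(* Let $M\ge 1$ and let $\{\mathbf{x}_m=[u_m,v_m]^T \leftrightarrow \mathbf{x}'_m=[u'_m,v'_m]^T\}_{m=1}^M$ be $M$ correspondences on two images. Then the $M\times 9$ real matrix $\mathbf{\Gamma}$ whose $m$-th row ($m=1,\dots,M$) is $$\begin{bmatrix}1 & u_m & v_m & u'_m & v'_m & u_mu'_m & u_mv'_m & v_mu'_m & v_mv'_m\end{bmatrix}$$ has rank at most $8$.
   Context: All quantities are real. World points are $\mathbf{X}_m=[x_m,y_m,z_m]^T\in\mathbb{R}^3$, and an image is described by a $3\times4$ real projection matrix. A projection matrix $\mathbf{P}$ maps the world point $\mathbf{X}_m$ to the image point $\mathbf{x}=[u,v]^T\in\mathbb{R}^2$ if $$\mathbf{P}\begin{bmatrix}\mathbf{X}_m\\1\end{bmatrix}=\begin{bmatrix}\omega u\\ \omega v\\ \omega\end{bmatrix}$$ for some nonzero scale $\omega\in\mathbb{R}$ (which may depend on the point and on the image). ''$\{\mathbf{x}_m\leftrightarrow\mathbf{x}'_m\}_{m=1}^M$ are $M$ correspondences on two images'' means: there exist world points $\mathbf{X}_1,\dots,\mathbf{X}_M\in\mathbb{R}^3$ and two projection matrices $\mathbf{P},\mathbf{Q}\in\mathbb{R}^{3\times4}$ such that, for every $m$, $\mathbf{P}$ maps $\mathbf{X}_m$ to $\mathbf{x}_m$ and $\mathbf{Q}$ maps $\mathbf{X}_m$ to $\mathbf{x}'_m$. *)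

(* Defs.v *)
From mathcomp Require Import all_boot all_order all_algebra.
From mathcomp Require Import reals.

Set Implicit Arguments.
Unset Strict Implicit.
Unset Printing Implicit Defensive.

Import Order.TTheory GRing.Theory Num.Theory.
Local Open Scope ring_scope.

Definition homogenize (R : realType) (n : nat) (x : 'cV[R]_n) : 'cV[R]_(n + 1) :=
  col_mx x 1%:M.

(* No rank condition is imposed on the projection matrix [P]. *)
Definition maps_to (R : realType) (P : 'M[R]_(3, 4))
    (X : 'cV[R]_3) (x : 'cV[R]_2) : Prop :=
  exists2 omega : R,
    omega != 0 & P *m homogenize X = omega *: homogenize x.

(* The world points and the two projection matrices are shared by all the
   pairs; only the scales in [maps_to] depend on the point and the image. *)
Definition correspondences (R : realType) (M : nat)
    (x x' : 'I_M -> 'cV[R]_2) : Prop :=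
  exists (X : 'I_M -> 'cV[R]_3) (P Q : 'M[R]_(3, 4)),
    forall m : 'I_M, maps_to P (X m) (x m) /\ maps_to Q (X m) (x' m).

Definition Gamma (R : realType) (M : nat)
    (x x' : 'I_M -> 'cV[R]_2) : 'M[R]_(M, 9) :=
  \matrix_(m < M, k < 9)
    (let u := x m 0 0 in let v := x m 1 0 in
     let u' := x' m 0 0 in let v' := x' m 1 0 in
     [:: 1; u; v; u'; v'; u * u'; u * v'; v * u'; v * v']`_k).

(* Main.v *)
(* If a nonzero row annihilates P or Q from the left, a rank-one bilinear form
   already vanishes on all pairs (P X, Q X).  Otherwise P has a right inverse P'
   and N = Q (1 - P' P) has rank at most 1, so there is a nonzero skew S with
   S N = 0.  Then S Q = S Q P' P, hence (Q X)^T S (Q P') (P X) = 0 for all X,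
   and S Q P' <> 0 because S Q <> 0.  The coefficients of the form are a nonzero
   vector in the kernel of Gamma.  In generic position this form is the
   fundamental matrix. *)
Require Import Defs.
From mathcomp Require Import all_boot all_order all_algebra.
From mathcomp Require Import reals.
From mathcomp Require Import ring.

Set Implicit Arguments.
Unset Strict Implicit.
Unset Printing Implicit Defensive.

Import Order.TTheory GRing.Theory Num.Theory.
Local Open Scope ring_scope.

Lemma nz_col_row_mul (K : fieldType) (m n : nat) (a : 'cV[K]_m) (b : 'rV[K]_n) :
  a != 0 -> b != 0 -> a *m b != 0.
Proof.
move=> /matrix0Pn[i [j]]; rewrite (ord1 j) => ai.
move=> /matrix0Pn[k [l]]; rewrite (ord1 k) => bl.
by apply/matrix0Pn; exists i, l; rewrite mxE big_ord1 mulf_neq0.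
Qed.

Lemma not_row_free_kernel (K : fieldType) (m n : nat) (A : 'M[K]_(m, n)) :
  ~~ row_free A -> exists2 a : 'rV[K]_m, a != 0 & a *m A = 0.
Proof.
rewrite -kermx_eq0 => kA; exists (nz_row (kermx A)); first by rewrite nz_row_eq0.
exact/sub_kermxP/nz_row_sub.
Qed.

(** Both terms evaluate to the product of the scalars [a *m y] and [b *m y], which commute. *)
Lemma skew_form_self (K : fieldType) (n : nat) (a b : 'rV[K]_n) (y : 'cV[K]_n) :
  y^T *m (a^T *m b - b^T *m a) *m y = 0.
Proof.
rewrite mulmxBr mulmxBl !mulmxA -!trmx_mul -!(mulmxA (_^T)).
rewrite [a *m y]mx11_scalar [b *m y]mx11_scalar !tr_scalar_mx.
by rewrite -!scalar_mxM mulrC subrr.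
Qed.

(** If the difference vanished, then [a 0 i * b 0 j = b 0 i * a 0 j] for all [j]; dividing by a
    nonzero [a 0 i] would make [b] a multiple of [a]. *)
Lemma skew_form_neq0 (K : fieldType) (n : nat) (a b : 'rV[K]_n) :
  a != 0 -> ~~ (b <= a)%MS -> a^T *m b - b^T *m a != 0.
Proof.
move=> /matrix0Pn[k [i]]; rewrite (ord1 k) => ai; apply: contra => /eqP/matrixP S0.
apply/sub_rVP; exists (b 0 i / a 0 i); apply/rowP => j.
have /eqP := S0 i j; rewrite !mxE !big_ord1 !mxE subr_eq0 => /eqP abE.
by rewrite mulrAC -abE mulrAC mulfV // mul1r.
Qed.

(** The left kernel contains two independent rows, and [S] is their wedge product. For [m = 3] it
    is, up to sign, the matrix of the cross product with their vector product. *)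
Lemma skew_left_kernel (K : fieldType) (m n : nat) (N : 'M[K]_(m, n)) :
  (\rank N + 2 <= m)%N ->
  exists S : 'M[K]_m,
    [/\ S != 0, S *m N = 0 & forall y : 'cV[K]_m, y^T *m S *m y = 0].
Proof.
move=> rN; have rk : (1 < \rank (kermx N))%N.
  by rewrite mxrank_ker -(leq_add2l (\rank N)) subnKC ?rank_leq_row.
set a := nz_row (kermx N).
have a0 : a != 0 by rewrite nz_row_eq0 -mxrank_eq0 -lt0n ltnW.
have aN : a *m N = 0 by apply/sub_kermxP/nz_row_sub.
(* A kernel of rank at least 2 does not fit in the line spanned by [a]. *)
have /row_subPn[i bi] : ~~ (kermx N <= a)%MS.
  by apply: contraL rk => /mxrankS le; rewrite -leqNgt (leq_trans le) ?rank_leq_row.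
have bN : row i (kermx N) *m N = 0 by apply/sub_kermxP/row_sub.
exists (a^T *m row i (kermx N) - (row i (kermx N))^T *m a); split.
- exact: skew_form_neq0.
- by rewrite mulmxBl -!mulmxA aN bN !mulmx0 subrr.
- exact: skew_form_self.
Qed.

Lemma exists_epipolar_form (K : fieldType) (P Q : 'M[K]_(3, 4)) :
  exists2 F : 'M[K]_3,
    F != 0 & forall X : 'cV[K]_4, (P *m X)^T *m F *m (Q *m X) = 0.
Proof.
have e0 : delta_mx 0 0 != 0 :> 'rV[K]_3.
  by apply/matrix0Pn; exists 0, 0; rewrite mxE oner_eq0.
have [fP|/not_row_free_kernel[a a0 aP]] := boolP (row_free P); last first.
  exists (a^T *m delta_mx 0 0); first by rewrite nz_col_row_mul ?trmx_eq0.
  by move=> X; rewrite !mulmxA -trmx_mul mulmxA aP mul0mx trmx0 !mul0mx.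
have [fQ|/not_row_free_kernel[b b0 bQ]] := boolP (row_free Q); last first.
  exists ((delta_mx 0 0)^T *m b); first by rewrite nz_col_row_mul ?trmx_eq0.
  by move=> X; rewrite -!mulmxA (mulmxA b) bQ mul0mx !mulmx0.
pose P' := pinvmx P; pose N := Q *m (1%:M - P' *m P).
have rN : (\rank N + 2 <= 3)%N.
  have /mulmx0_rank_max : P *m (1%:M - P' *m P) = 0.
    by rewrite mulmxBr mulmx1 mulmxA mulmxVp // mul1mx subrr.
  (* The ranks of [P] and [1 - P' P] add up to at most 4, and [P] has rank 3. *)
  rewrite (eqP fP) (leq_add2l 3 _ 1) => r1.
  by rewrite (leq_add2r 2 _ 1) (leq_trans (mxrankM_maxr _ _)).
have [S [S0 SN Sskew]] := skew_left_kernel rN.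
have SQ : S *m Q = S *m Q *m P' *m P.
  apply/eqP; rewrite -subr_eq0 -SN /N mulmxBr mulmx1 mulmxBr.
  by rewrite !mulmxA.
(* The transpose puts [P X] on the left of the form, as the statement requires. *)
exists (S *m Q *m P')^T => [|X].
  rewrite trmx_eq0; apply: contra S0 => /eqP SQP'.
  (* [Q] is right invertible, so [S Q = 0] would force [S = 0]. *)
  by rewrite -(mulmx1 S) -(mulmxVp fQ) mulmxA SQ SQP' !mul0mx.
apply: trmx_inj; rewrite trmx0 -trmx_mul [LHS]trmx_mul trmxK -[RHS](Sskew (Q *m X)).
by rewrite -[RHS]mulmxA (mulmxA S) [in RHS]SQ !mulmxA.
Qed.

Lemma maps_to_epipolar (R : realType) (P Q : 'M[R]_(3, 4)) (F : 'M[R]_3)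
    (X : 'cV[R]_3) (x x' : 'cV[R]_2) :
  (forall Y : 'cV[R]_4, (P *m Y)^T *m F *m (Q *m Y) = 0) ->
  maps_to P X x -> maps_to Q X x' ->
  (homogenize x)^T *m F *m homogenize x' = 0.
Proof.
move=> FPQ [w w0 PX] [w' w'0 QX]; have := FPQ (homogenize X).
(* By bilinearity the two scales come out as a nonzero factor [w * w']. *)
rewrite PX QX [(w *: _)^T]linearZ /= -!scalemxAl -scalemxAr scalerA => /eqP.
by rewrite scaler_eq0 mulf_eq0 (negPf w0) (negPf w'0) => /eqP.
Qed.

(* The coefficients [F i j] in the order of the columns of [Gamma], where
   index [2] stands for the homogenizing coordinate. *)
Definition Gamma_vec (R : realType) (F : 'M[R]_3) : 'cV[R]_9 :=
  \col_k [:: F 2 2; F 0 2; F 1 2; F 2 0; F 2 1; F 0 0; F 0 1; F 1 0; F 1 1]`_k.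

Lemma Gamma_vec_eq0 (R : realType) (F : 'M[R]_3) : Gamma_vec F = 0 -> F = 0.
Proof.
move=> /colP f0.
have F0 k : (k < 9)%N ->
    [:: F 2 2; F 0 2; F 1 2; F 2 0; F 2 1; F 0 0; F 0 1; F 1 0; F 1 1]`_k = 0.
  by move=> k9; have := f0 (Ordinal k9); rewrite !mxE.
apply/matrixP => i j; rewrite mxE.
have ord3E (k : 'I_3) : [\/ k = 0, k = 1 | k = 2].
  by case: k => [[|[|[|//]]] ?]; [apply: Or31 | apply: Or32 | apply: Or33];
     apply: val_inj.
case: (ord3E i) => ->; case: (ord3E j) => ->.
- exact: (F0 5).
- exact: (F0 6).
- exact: (F0 1).
- exact: (F0 7).
- exact: (F0 8).
- exact: (F0 2).
- exact: (F0 3).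
- exact: (F0 4).
- exact: (F0 0).
Qed.

(** Reading block entries off a list lets the expansion of the form reduce to a [ring] identity. *)
Lemma homogenizeE (R : realType) (x : 'cV[R]_2) (i : 'I_3) :
  homogenize x i 0 = [:: x 0 0; x 1 0; 1]`_i.
Proof.
rewrite mxE; case: splitP => j ij; rewrite ij.
  by case: j {ij} => [[|[|//]] ?] /=; congr (x _ _); apply: val_inj.
by rewrite (ord1 j) mxE.
Qed.

Lemma Gamma_mul_vec (R : realType) (M : nat) (x x' : 'I_M -> 'cV[R]_2)
    (F : 'M[R]_3) (m : 'I_M) :
  (Gamma x x' *m Gamma_vec F) m 0 =
  ((homogenize (x m))^T *m F *m homogenize (x' m)) 0 0.
Proof.
rewrite !mxE; under eq_bigr do rewrite !mxE.
under [RHS]eq_bigr => j _.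
  rewrite mxE homogenizeE; under eq_bigr do rewrite mxE homogenizeE; over.
have sum3E (g : 'I_3 -> R) : \sum_i g i = g 0 + g 1 + g 2.
  rewrite !big_ord_recr big_ord0 /= add0r.
  by congr (g _ + g _ + g _); apply: val_inj.
rewrite !sum3E !big_ord_recr big_ord0 /=; ring.
Qed.

Theorem theorem1 (R : realType) (M : nat) (hM : (1 <= M)%N)
    (x x' : 'I_M -> 'cV[R]_2) (hcorr : correspondences x x') :
  (\rank (Gamma x x') <= 8)%N.
Proof.
have [X [P [Q PQX]]] := hcorr.
have [F F0 FPQ] := exists_epipolar_form P Q.
have Gf : Gamma x x' *m Gamma_vec F = 0.
  apply/colP => m; have [PX QX] := PQX m.
  by rewrite Gamma_mul_vec (maps_to_epipolar FPQ PX QX) !mxE.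
(* Rank 9 would give [Gamma] a left inverse, hence [Gamma_vec F = 0] and [F = 0]. *)
rewrite -ltnS ltn_neqAle rank_leq_col andbT.
apply: contra F0 => fG; apply/eqP/Gamma_vec_eq0.
by rewrite -(mul1mx (Gamma_vec F)) -(mulVpmx fG) -mulmxA Gf mulmx0.
Qed.
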